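(* Let $\phi=g-h$ and let $x^k$ be an iterate of IBDCA (described in the context) with $x^k\in\operatorname{dom}g$, with associated $y^k$ and $d^k=y^k-x^k$. Then: 1. $\phi'(x^k;d^k)\le-\rho\|d^k\|^2$; 2. for every $0\le\alpha<\rho$ there exists $\sigma_k>0$ such that for all $\lambda\in(0,\sigma_k]$, $$\phi(x^k+\lambda d^k)\le\phi(x^k)-\alpha\lambda\|d^k\|^2 .$$
   Context: **Problem.** Minimize $\phi(x)=g(x)-h(x)$ over $\mathbb{R}^m$, where $g,h:\mathbb{R}^m\to\mathbb{R}\cup\{+\infty\}$ are proper convex functions, with the conventions $(+\infty)-(+\infty)=+\infty$, $(+\infty)-c=+\infty$, $c-(+\infty)=-\infty$ for $c\in\mathbb{R}$. $\partial g$ is the convex subdifferential, $\operatorname{dom}g=\{x: g(x)<+\infty\}$, and for a function $f$ and $x\in\operatorname{dom}f$ the directional derivative is $f'(x;d)=\lim_{t\downarrow0}(f(x+td)-f(x))/t$. A function $f$ is strongly convex with modulus $\rho>0$ if $f-\frac{\rho}{2}\|\cdot\|^2$ is convex. **Standing assumptions.** (i) $g$ and $h$ are both strongly convex with modulus $\rho>0$. (ii) For all $x\in\operatorname{dom}g$ and $d\in\mathbb{R}^m$, $g'(x;d)=\sup_{v\in\partial g(x)}\langle v,d\rangle$. (iii) $h$ is continuously differentiable with locally Lipschitz gradient on an open set containing $\operatorname{dom}g$, and $\inf_{x\in\mathbb{R}^m}\phi(x)>-\infty$. (iv) The algorithm is well defined: $h$ is differentiable at every iterate $x^k$ and the subproblem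 defining $y^k$ has a unique solution. **Algorithm IBDCA.** Fix $\bar\lambda>1$ and $0<\beta<1$, and an initial point $x^0$. For $k=0,1,2,\dots$: - let $y^k$ be the unique solution of $\min_{x\in\mathbb{R}^m} g(x)-\langle\nabla h(x^k),x\rangle$; - set $d^k=y^k-x^k$; if $d^k=0$, stop and return $x^k$; - choose any $\alpha_k>0$ and any trial step $\lambda_k\in(0,\bar\lambda]$; replace $\lambda_k$ by $\beta\lambda_k$ repeatedly until either $\lambda_k\le1$, or both $\phi(x^k+\lambda_kd^k)\le\phi(x^k)-\alpha_k\lambda_k\|d^k\|^2$ and $\phi(x^k+\lambda_kd^k)\le\phi(y^k)$ hold; if $\lambda_k\le 1$, set $\lambda_k=1$; - set $x^{k+1}=x^k+\lambda_kd^k$; if $x^{k+1}=x^k$, stop and return $x^k$. *)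

(* Defs.v *)
From HB Require Import structures.
From mathcomp Require Import all_boot all_order all_algebra.
From mathcomp Require Import all_classical all_reals all_analysis.
Set Implicit Arguments.
Unset Strict Implicit.
Unset Printing Implicit Defensive.
Import Order.TTheory GRing.Theory Num.Theory.
Import numFieldNormedType.Exports.
Local Open Scope classical_set_scope.
Local Open Scope ring_scope.

(* R^m is 'rV[R]_m.  The library norm `|_| on 'rV[R]_m is the sup norm, whose
   topology is the Euclidean one; the Euclidean norm itself is enorm. *)

Definition dotv (R : realType) (m : nat) (u v : 'rV[R]_m) : R :=
  \sum_(i < m) u 0 i * v 0 i.

Definition enorm (R : realType) (m : nat) (u : 'rV[R]_m) : R :=
  Num.sqrt (dotv u u).

Section ExtendedValued.
Context (R : realType) (m : nat).
Implicit Types (f g h : 'rV[R]_m -> \bar R) (x y z d v : 'rV[R]_m).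

Definition edom f : set 'rV[R]_m := [set x | (f x < +oo)%E].

Definition eproper f : Prop :=
  (forall x, f x <> -oo%E) /\ (exists x, edom f x).

Definition econvex f : Prop :=
  forall x y (t : R), 0 < t -> t < 1 ->
    (f (t *: x + (1 - t) *: y)%R <= t%:E * f x + (1 - t)%:E * f y)%E.

Definition strongly_convex (rho : R) f : Prop :=
  econvex (fun x => f x - (rho / 2 * enorm x ^+ 2)%:E)%E.

Definition subdifferential f x : set 'rV[R]_m :=
  [set v | forall z, (f x + (dotv v (z - x)%R)%:E <= f z)%E].

(* f'(x;d) exists in [-oo, +oo] and equals l; meaningful when f x is finite. *)
Definition has_dirderiv f x d (l : \bar R) : Prop :=
  ((f (x + t *: d)%R - f x) * (t^-1)%:E)%E @[t --> 0^'+] --> l.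

Definition edifferentiable f x : Prop :=
  (\forall z \near x, f z \is a fin_num) /\ differentiable (fine \o f) x.

Definition gradient f x : 'rV[R]_m :=
  \row_(i < m) 'D_(delta_mx 0 i) (fine \o f) x.

Definition C1_locally_lipschitz_gradient f (U : set 'rV[R]_m) : Prop :=
  [/\ forall x, U x -> edifferentiable f x,
      forall x, U x -> {for x, continuous (gradient f)} &
      forall x, U x ->
        exists2 V, nbhs x V & [lipschitz (gradient f z) | z in V]].

(* The dual difference %dE is the one for which (+oo) - (+oo) = +oo. *)
Definition dc g h x : \bar R := (g x - h x)%dE.

Definition minimizer f y : Prop := forall z, (f y <= f z)%E.

Definition subproblem g h x z : \bar R :=
  (g z - (dotv (gradient h x) z)%:E)%E.

(* Stopping test of the backtracking loop for the trial step l. *)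
Definition ibdca_accept g h (a : R) x y (l : R) : Prop :=
  l <= 1 \/
  ((dc g h (x + l *: (y - x))%R <=
      dc g h x - (a * l * enorm (y - x) ^+ 2)%:E)%E /\
   (dc g h (x + l *: (y - x))%R <= dc g h y)%E).

(* l is the step produced by backtracking from the trial step l0. *)
Definition ibdca_linesearch g h (beta a : R) x y (l0 l : R) : Prop :=
  exists n : nat,
    [/\ forall j, (j < n)%N -> ~ ibdca_accept g h a x y (beta ^+ j * l0),
        ibdca_accept g h a x y (beta ^+ n * l0) &
        l = if beta ^+ n * l0 <= 1 then 1 else beta ^+ n * l0].

(* Iteration k is reached: no earlier iteration stopped the algorithm. *)
Definition ibdca_reached (x y : nat -> 'rV[R]_m) (k : nat) : Prop :=
  forall j, (j < k)%N -> y j - x j != 0 /\ x j.+1 != x j.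

(* A run of the algorithm from the arbitrary starting point x 0; after the
   algorithm has stopped, the sequences are unconstrained. *)
Definition ibdca_run g h (lbar beta : R)
    (x y : nat -> 'rV[R]_m) (alpha lambda : nat -> R) : Prop :=
  forall k, ibdca_reached x y k ->
    minimizer (subproblem g h (x k)) (y k) /\
    (y k - x k != 0 ->
      [/\ 0 < alpha k,
          exists2 l0 : R, 0 < l0 <= lbar &
            ibdca_linesearch g h beta (alpha k) (x k) (y k) l0 (lambda k) &
          x k.+1 = x k + lambda k *: (y k - x k)]).

Definition ibdca_well_defined g h (x y : nat -> 'rV[R]_m) : Prop :=
  forall k, ibdca_reached x y k ->
    edifferentiable h (x k) /\ exists! z, minimizer (subproblem g h (x k)) z.

End ExtendedValued.

(* Main.v *)
(* Optimality of y^k means that grad h(x^k) is a subgradient of g at y^k.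
   Strong convexity makes the subdifferential of g strongly monotone, so that every
   subgradient v of g at x^k satisfies
     <v, d^k> <= <grad h(x^k), d^k> - rho |d^k|^2.
   The supremum over v is g'(x^k; d^k), which gives the first claim; the second
   follows because the difference quotients of phi eventually stay below any
   bound exceeding their limit. *)
Require Import Defs.
From mathcomp Require Import all_boot all_order all_algebra.
From mathcomp Require Import all_classical all_reals all_analysis.
From mathcomp Require Import ring lra.
Import Order.TTheory GRing.Theory Num.Theory.
Import numFieldNormedType.Exports.
Local Open Scope classical_set_scope.
Local Open Scope ring_scope.

Section Dot.
Set Implicit Arguments.
Unset Strict Implicit.
Context (R : realType) (m : nat).
Implicit Types (u v w : 'rV[R]_m) (t : R).

Lemma dotvDr u v w : dotv u (v + w) = dotv u v + dotv u w.
Proof.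
by rewrite /dotv -big_split; apply: eq_bigr => i _; rewrite mxE mulrDr.
Qed.

Lemma dotvZr u t v : dotv u (t *: v) = t * dotv u v.
Proof.
by rewrite /dotv mulr_sumr; apply: eq_bigr => i _; rewrite mxE mulrCA.
Qed.

Lemma dotvBr u v w : dotv u (v - w) = dotv u v - dotv u w.
Proof. by rewrite -scaleN1r dotvDr dotvZr mulN1r. Qed.

Lemma sqr_enorm u : enorm u ^+ 2 = dotv u u.
Proof.
by rewrite sqr_sqrtr //; apply: sumr_ge0 => i _; rewrite -expr2 sqr_ge0.
Qed.

Lemma enorm_gt0 u : u != 0 -> 0 < enorm u.
Proof.
rewrite sqrtr_gt0 lt_def => u0.
have sq_ge0 i : 0 <= u 0 i * u 0 i by rewrite -expr2 sqr_ge0.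
rewrite sumr_ge0 // andbT; apply: contraNneq u0 => /eqP.
rewrite psumr_eq0 // => /allP u0; apply/eqP/rowP => i; rewrite mxE.
by apply/eqP; move: (u0 i (mem_index_enum i)); rewrite mulf_eq0 orbb.
Qed.

Lemma enorm_subC u v : enorm (u - v) = enorm (v - u).
Proof.
by congr Num.sqrt; apply: eq_bigr => i _; rewrite !mxE; ring.
Qed.

(** The last term is the exact convexity gap of the squared norm; it turns strong convexity into a
    quadratic gain. *)
Lemma sqr_enorm_convex_comb t u v :
  enorm (t *: u + (1 - t) *: v) ^+ 2 =
  t * enorm u ^+ 2 + (1 - t) * enorm v ^+ 2 - t * (1 - t) * enorm (u - v) ^+ 2.
Proof.
rewrite !sqr_enorm /dotv !mulr_sumr -big_split -sumrB.
by apply: eq_bigr => i _; rewrite !mxE /=; ring.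
Qed.

End Dot.

Section Subgradients.
Set Implicit Arguments.
Unset Strict Implicit.
Context (R : realType) (m : nat).
Implicit Types (f g h : 'rV[R]_m -> \bar R) (x y z d v w : 'rV[R]_m).

Lemma edom_fin_num f x : (forall z, f z <> -oo%E) -> edom f x ->
  f x \is a fin_num.
Proof.
by move=> /(_ x) /eqP fx_ninfty fx; rewrite fin_numE fx_ninfty lt_eqF.
Qed.

Lemma subdifferential_edom f x v z :
  subdifferential f x v -> edom f z -> edom f x.
Proof.
move=> /(_ z) fxz fz; rewrite /edom /=.
move: (le_lt_trans fxz fz); case: (f x) => [r _| |_] //; by rewrite ?ltry ?ltNyr.
Qed.

Lemma strong_subgradient rho f x v z :
  (forall z, f z <> -oo%E) -> strongly_convex rho f -> edom f x ->
  subdifferential f x v ->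
  (f x + (dotv v (z - x) + rho / 2 * enorm (z - x) ^+ 2)%:E <= f z)%E.
Proof.
move=> f_ninfty f_strong fx fv.
have [fz|] := ltP (f z) +oo%E; last by rewrite leye_eq => /eqP ->; rewrite leey.
have /fineK fxE := edom_fin_num f_ninfty fx.
have /fineK fzE := edom_fin_num f_ninfty (fz : edom f z).
rewrite -fxE -fzE -EFinD lee_fin.
set a := fine (f x); set b := fine (f z); set q := enorm (z - x) ^+ 2.
(* Compare the convexity bound at the point x + t (z - x) with the subgradient
   bound there and divide by t; the claim is the limit t -> 0. *)
have slope t : 0 < t -> t < 1 ->
    a + dotv v (z - x) + rho / 2 * q <= b + t * (rho / 2 * q).
  move=> t0 t1; have := f_strong z x t t0 t1.
  set p := t *: z + (1 - t) *: x.
  have pE : p - x = t *: (z - x) by apply/rowP => i; rewrite !mxE; ring.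
  have := fv p; rewrite pE dotvZr -fxE -fzE -/a -/b.
  case fp : (f p) (f_ninfty p) => [c| |] // _; rewrite /= ?lee_fin ?leNye //.
  (* The squared norms of [z] and [x] cancel, leaving [t * (1 - t) * (rho / 2 * q)], which is
     divisible by [t]. *)
  rewrite sqr_enorm_convex_comb -/q => ap cp.
  rewrite -(ler_pM2l t0); nra.
(* If the quadratic term is nonpositive, so is the error [t * (rho / 2 * q)], and [t = 1 / 2]
   suffices. *)
have [q0|q0] := leP (rho / 2 * q) 0.
  have := slope (1 / 2); rewrite divr_gt0 // => /(_ isT).
  by move=> /(_ ltac:(lra)); nra.
apply/ler_addgt0Pr => e e0.
(* The minimum keeps [t] below 1 and the error term at most [e]. *)
pose t := Num.min (1 / 2) (e / (rho / 2 * q)).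
have t0 : 0 < t by rewrite lt_min divr_gt0 //= divr_gt0.
have t1 : t < 1 by rewrite gt_min; apply/orP; left; lra.
rewrite addrA (le_trans (slope _ t0 t1)) // lerD2l -ler_pdivlMr //.
by rewrite ge_min lexx orbT.
Qed.

(** Add the strong subgradient inequalities at [x] and [y]: the values of [f] cancel and each
    contributes half of the quadratic term. *)
Lemma subdifferential_strongly_monotone rho f x y v w :
  (forall z, f z <> -oo%E) -> strongly_convex rho f -> edom f x ->
  subdifferential f x v -> subdifferential f y w ->
  dotv v (y - x) <= dotv w (y - x) - rho * enorm (y - x) ^+ 2.
Proof.
move=> f_ninfty f_strong fx fv fw; have fy := subdifferential_edom fw fx.
have := strong_subgradient y f_ninfty f_strong fx fv.
have := strong_subgradient x f_ninfty f_strong fy fw.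
rewrite -(fineK (edom_fin_num f_ninfty fx)) -(fineK (edom_fin_num f_ninfty fy)).
rewrite -!EFinD !lee_fin (enorm_subC x y) !dotvBr; lra.
Qed.

Lemma subproblem_minimizer_subgradient g h x y :
  minimizer (subproblem g h x) y -> subdifferential g y (gradient h x).
Proof.
move=> min_y z; have := min_y z; rewrite /subproblem dotvBr.
case: (g y) (g z) => [a| |] [b| |] //=; rewrite ?lee_fin ?leey ?leNye //; lra.
Qed.

Lemma near_line_fin_num h x d : edifferentiable h x ->
  \forall t \near 0^'+, h (x + t *: d) \is a fin_num.
Proof.
move=> [h_fin _].
have line_cvg : x + t *: d @[t --> 0^'+] --> x.
  rewrite -[X in _ --> X](addr0 x) -(scale0r d).
  apply: cvgD; first exact: cvg_cst.
  by apply: cvgZr_tmp; apply: cvg_at_right_filter; exact: cvg_id.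
exact: line_cvg h_fin.
Qed.

Lemma dirderiv_differentiable h x d : edifferentiable h x ->
  has_dirderiv h x d (dotv (gradient h x) d)%:E.
Proof.
move=> h_ediff; have [h_fin h_diff] := h_ediff.
have hx := nbhs_singleton h_fin.
have line_fin := near_line_fin_num d h_ediff.
(* The differential is linear in the direction, so [d] can be expanded in the standard basis. *)
have -> : dotv (gradient h x) d = 'D_d (fine \o h) x.
  rewrite [in RHS]deriveE // [in RHS](row_sum_delta d) linear_sum.
  by apply: eq_bigr => i _; rewrite mxE deriveE // linearZ mulrC.
apply: cvg_EFin.
  near=> t; rewrite fin_numM // fin_numB hx andbT; near: t; exact: line_fin.
apply: cvg_trans (cvg_dnbhs_at_right (diff_derivable (v := d) h_diff)).
apply: near_eq_cvg; near=> t => /=.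
have ht : h (x + t *: d) \is a fin_num by near: t; exact: line_fin.
by rewrite fineM ?fin_numB ?ht ?hx // fineB //= mulrC [_ + x]addrC.
Unshelve. all: by end_near. Qed.

(** The two extended differences disagree only on opposite infinities, which a finite [h x]
    excludes. *)
Lemma dc_fin_num g h x : h x \is a fin_num -> dc g h x = (g x - h x)%E.
Proof. by rewrite /dc; case: (h x) => // b _; case: (g x). Qed.

Lemma dirderiv_dc g h x d a b :
  (forall z, g z <> -oo%E) -> edom g x -> edifferentiable h x ->
  has_dirderiv g x d a -> has_dirderiv h x d b%:E ->
  has_dirderiv (dc g h) x d (a - b%:E)%E.
Proof.
move=> g_ninfty gx h_diff g_a h_b.
have gx_fin := edom_fin_num g_ninfty gx.
have hx_fin := nbhs_singleton h_diff.1.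
(* The difference of the limits is well defined even for infinite [a], since [b] is real. *)
apply: cvg_trans (cvgeB _ g_a h_b); last by rewrite fin_num_adde_defl.
apply: near_eq_cvg; near=> t => /=.
have t_gt0 : 0 < t by [].
have ht : h (x + t *: d) \is a fin_num.
  near: t; exact: near_line_fin_num.
rewrite !dc_fin_num // -(fineK gx_fin) -(fineK hx_fin) -(fineK ht).
(* Where [g] is [+oo] on the ray, both quotients equal [+oo]. *)
case: (g (x + t *: d)) (g_ninfty (x + t *: d)) => [c| |] // _.
  by congr EFin; ring.
by rewrite /= gt0_mulye // lte_fin invr_gt0.
Unshelve. all: by end_near. Qed.

Lemma dirderiv_descent f x d l c :
  f x \is a fin_num -> has_dirderiv f x d l -> (l < c%:E)%E ->
  exists2 sigma : R, 0 < sigma &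
    forall t, 0 < t -> t <= sigma -> (f (x + t *: d)%R <= f x + (t * c)%:E)%E.
Proof.
move=> fx f_l l_c.
have [e e_gt0 quotient_lt] : \forall t \near 0^'+,
    (((f (x + t *: d)%R - f x) * (t^-1)%:E)%E < c%:E)%E.
  exact: f_l (open_ereal_lt' l_c).
(* Halving [e] puts the closed range [t <= sigma] inside the open ball of radius [e]. *)
exists (e / 2) => [|t t_gt0 t_le]; first exact: divr_gt0.
have : ball 0 e t.
  by rewrite /ball /= sub0r normrN gtr0_norm // (le_lt_trans t_le) //; lra.
move=> /quotient_lt /(_ t_gt0).
rewrite -(fineK fx); case: (f (x + t *: d)) => [r| |]; rewrite ?leNye //.
  by rewrite -EFinN -!EFinD -EFinM lte_fin lee_fin ltr_pdivrMr //; lra.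
by rewrite /= gt0_mulye // lte_fin invr_gt0.
Qed.

End Subgradients.

Theorem proposition5 (R : realType) (m : nat) (g h : 'rV[R]_m -> \bar R)
  (rho lbar beta : R)
  (x y : nat -> 'rV[R]_m) (alpha lambda : nat -> R)
  (g_proper : eproper g) (g_convex : econvex g)
  (h_proper : eproper h) (h_convex : econvex h)
  (rho_gt0 : 0 < rho)
  (g_strong : strongly_convex rho g) (h_strong : strongly_convex rho h)
  (g_dirderiv : forall z d : 'rV[R]_m, edom g z ->
     has_dirderiv g z d
       (ereal_sup [set (dotv v d)%:E | v in subdifferential g z]))
  (h_C1 : exists U : set 'rV[R]_m,
     [/\ open U, edom g `<=` U & C1_locally_lipschitz_gradient h U])
  (phi_inf : (-oo < ereal_inf (range (dc g h)))%E)
  (lbar_gt1 : 1 < lbar) (beta_gt0 : 0 < beta) (beta_lt1 : beta < 1)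
  (run : ibdca_run g h lbar beta x y alpha lambda)
  (well_defined : ibdca_well_defined g h x y)
  (k : nat) (reached : ibdca_reached x y k) (xk_dom : edom g (x k)) :
  let phi := dc g h in
  let d := y k - x k in
  (exists2 l : \bar R,
     has_dirderiv phi (x k) d l & (l <= (- rho * enorm d ^+ 2)%:E)%E) /\
  (forall a : R, 0 <= a -> a < rho ->
     exists2 sigma : R, 0 < sigma &
       forall l : R, 0 < l -> l <= sigma ->
         (phi (x k + l *: d)%R <= phi (x k) - (a * l * enorm d ^+ 2)%:E)%E).
Proof.
move=> phi d.
have [min_y _] := run _ reached.
have [h_diff _] := well_defined _ reached.
have [g_ninfty _] := g_proper.
have phi_deriv := dirderiv_dc g_ninfty xk_dom h_diff (g_dirderiv _ d xk_dom)
  (dirderiv_differentiable (d := d) h_diff).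
set l := (_ - _)%E in phi_deriv.
have l_le : (l <= (- rho * enorm d ^+ 2)%:E)%E.
  (* With the finite term moved to the right, it remains to bound each subgradient separately. *)
  rewrite leeBlDr // -EFinD; apply: ge_ereal_sup => _ [v gv <-].
  rewrite lee_fin mulNr addrC.
  have gy := subproblem_minimizer_subgradient min_y.
  exact: subdifferential_strongly_monotone g_ninfty g_strong xk_dom gv gy.
split; first by exists l.
move=> a a_ge0 a_lt.
(* For [d = 0] there is no strict gap below, but both sides equal [phi (x k)], so any [sigma]
   works. *)
have [->|d_neq0] := eqVneq d 0.
  exists 1 => // t _ _; rewrite scaler0 addr0.
  by rewrite sqr_enorm /dotv big1 ?mulr0 ?sube0 // => i _; rewrite mxE mul0r.
have phi_fin : phi (x k) \is a fin_num.
  have h_fin := nbhs_singleton h_diff.1.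
  by rewrite /phi dc_fin_num // fin_numB (edom_fin_num g_ninfty xk_dom).
(* Strictness comes from [a < rho] together with [enorm d > 0]. *)
have l_lt : (l < (- (a * enorm d ^+ 2))%:E)%E.
  rewrite -mulNr; apply: le_lt_trans l_le _; rewrite lte_fin ltr_pM2r ?ltrN2 //.
  by rewrite exprn_gt0 // enorm_gt0.
have [sigma sigma_gt0 descent] := dirderiv_descent phi_fin phi_deriv l_lt.
exists sigma => // t t_gt0 t_le; apply: le_trans (descent t t_gt0 t_le) _.
by rewrite mulrN EFinN mulrCA mulrA.
Qed.
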